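(* Consider a Markov decision process with finite state space $\mathcal{S}$ and finite action space $\mathcal{A}$. Let $\Pi$ be the set of all deterministic policies $\mathcal{S}\to\mathcal{A}$, so $|\Pi|=|\mathcal{A}|^{|\mathcal{S}|}$. Let $\pi_b$ be a behavior policy and let $\mathcal{D}=\{(s^i,a^i)\}_{i=1}^{|\mathcal{D}|}$ be a dataset of state-action pairs drawn i.i.d. from the state-action occupancy distribution $\rho_{\pi_b}(s,a)$. Assume that there does not exist a policy $\pi\in\Pi$ such that $\pi(s^i)=a^i$ for all $i\in\{1,\dots,|\mathcal{D}|\}$. Let $\hat{\pi}_b$ be the empirical behavior policy and $\rho_{\hat{\pi}_b}$ its state marginal occupancy (the empirical distribution of the states in $\mathcal{D}$). Suppose behavior cloning begins from an initial policy $\pi_0$ (with state occupancy $\rho_{\pi_0}$) and returns the policy $\pi\in\Pi$. Then for any $\delta>0$ (with $\delta<1$), with probability at least $1-\delta$, \[ D_{\mathrm{TV}}(\rho_{\pi}(s,a)\,\|\,\rho_{\pi_b}(s,a)) \le c(\pi_0,\pi_b,|\mathcal{D}|), \] where \[ \begin{aligned} c(\pi_0,\pi_b,|\mathcal{D}|) ={}& \tfrac{1}{2}\sum_{s\notin\mathcal{D}}\rho_{\pi_b}(s) + \tfrac{1}{2}\sum_{s\notin\mathcal{D}}|\rho_\pi(s)-\rho_{\pi_0}(s)| + \tfrac{1}{2}\sum_{s\notin\mathcal{D}}|\rho_{\pi_0}(s)-\rho_{\pi_b}(s)| \\ &+ \tfrac{1}{2}\sum_{s\in\mathcal{D}}|\rho_\pi(s)-\rho_{\hat{\pi}_b}(s)|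 + \frac{1}{|\mathcal{D}|}\sum_{i=1}^{|\mathcal{D}|}\mathbb{I}\left[\pi(s^i)\neq a^i\right] \\ &+ \left[\frac{\log|\mathcal{S}|+\log(2/\delta)}{2|\mathcal{D}|}\right]^{1/2} + \left[\frac{\log|\Pi|+\log(2/\delta)}{2|\mathcal{D}|}\right]^{1/2}. \end{aligned} \]
   Context: For a policy $\pi$, the occupancy measure is $\rho_\pi(s,a)=\sum_{t\ge0}\gamma^t P(s_t=s,a_t=a\mid\pi)=\pi(a|s)\rho_\pi(s)$ with state occupancy $\rho_\pi(s)=\sum_{t\ge 0}\gamma^tP(s_t=s\mid\pi)$, where $\gamma\in[0,1]$ is the discount factor; these are treated as distributions. The empirical behavior policy is $\hat{\pi}_b(a|s)=\frac{\sum_{(s',a')\in\mathcal{D}}\mathbb{I}[s'=s,a'=a]}{\sum_{s'\in\mathcal{D}}\mathbb{I}[s'=s]}$. ''$s\in\mathcal{D}$'' means $s$ equals one of the states $s^i$ in the dataset, and ''$s\notin\mathcal{D}$'' means it does not. For a deterministic policy $\pi$, $\pi(s)$ denotes the action it selects at $s$. $\mathbb{I}$ is the indicator function, and $D_{\mathrm{TV}}(p\|q)=\frac12\sum_x|p(x)-q(x)|$.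
   Formalization: The discount factor is taken in [0,1) instead of [0,1], because at γ=1 the occupancy series diverges and is not a distribution; for γ<1 the occupancy is normalized by the factor 1−γ. *)

(* Defs.v *)
From mathcomp Require Import all_boot all_order all_algebra.
From mathcomp Require Import all_classical all_reals all_analysis.
Set Implicit Arguments. Unset Strict Implicit. Unset Printing Implicit Defensive.
Import Order.TTheory GRing.Theory Num.Theory.
Local Open Scope ring_scope.

Section MDP.
Variables (R : realType) (S A : finType).

Definition spolicy := {ffun S -> {ffun A -> R}}.
Definition mdp_kernel := {ffun S -> {ffun A -> {ffun S -> R}}}.

Definition is_dist (T : finType) (p : T -> R) :=
  (forall x, 0 <= p x) /\ \sum_(x : T) p x = 1.

Definition is_spolicy (pi : spolicy) := forall s, is_dist (pi s).
Definition is_kernel (P : mdp_kernel) := forall s a, is_dist (P s a).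

Definition det_pol (pi : {ffun S -> A}) : spolicy :=
  [ffun s => [ffun a => if a == pi s then 1 else 0]].

Fixpoint state_dist (mu : {ffun S -> R}) (P : mdp_kernel) (pi : spolicy) (t : nat)
    : S -> R :=
  match t with
  | 0 => fun s => mu s
  | t'.+1 => fun s' =>
      \sum_(s : S) \sum_(a : A)
        state_dist mu P pi t' s * pi s a * P s a s'
  end.

(* State occupancy, normalised to a distribution:
   rho_pi(s) = (1 - gamma) * sum_{t>=0} gamma^t P(s_t = s | pi). *)
Definition occ (gamma : R) (mu : {ffun S -> R}) (P : mdp_kernel) (pi : spolicy)
    (s : S) : R :=
  (1 - gamma) *
    limn (fun n => \sum_(0 <= t < n) gamma ^+ t * state_dist mu P pi t s).

Definition occSA (gamma : R) (mu : {ffun S -> R}) (P : mdp_kernel) (pi : spolicy)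
    (sa : S * A) : R :=
  pi sa.1 sa.2 * occ gamma mu P pi sa.1.

Definition dTV (T : finType) (p q : T -> R) : R :=
  2^-1 * \sum_(x : T) `|p x - q x|.

Definition dataset (N : nat) := {ffun 'I_N -> S * A}.

Definition in_data N (D : dataset N) (s : S) : bool :=
  [exists i : 'I_N, (D i).1 == s].

Definition emp_state N (D : dataset N) (s : S) : R :=
  (#|[set i : 'I_N | (D i).1 == s]|%:R) / N%:R.

Definition emp_pol N (D : dataset N) (s : S) (a : A) : R :=
  (#|[set i : 'I_N | D i == (s, a)]|%:R) / (#|[set i : 'I_N | (D i).1 == s]|%:R).

Definition prob_iid N (q : S * A -> R) (E : dataset N -> bool) : R :=
  \sum_(D : dataset N) (\prod_(i : 'I_N) q (D i)) * (E D)%:R.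

Definition realizable N (D : dataset N) : bool :=
  [exists pi : {ffun S -> A}, [forall i : 'I_N, pi (D i).1 == (D i).2]].

Definition cbound (gamma : R) (mu : {ffun S -> R}) (P : mdp_kernel)
    (pib pi0 : spolicy) (pi : {ffun S -> A}) (delta : R) N (D : dataset N) : R :=
  let rpi := occ gamma mu P (det_pol pi) in
  let r0 := occ gamma mu P pi0 in
  let rb := occ gamma mu P pib in
  2^-1 * \sum_(s | ~~ in_data D s) rb s
  + 2^-1 * \sum_(s | ~~ in_data D s) `|rpi s - r0 s|
  + 2^-1 * \sum_(s | ~~ in_data D s) `|r0 s - rb s|
  + 2^-1 * \sum_(s | in_data D s) `|rpi s - emp_state D s|
  + N%:R^-1 * \sum_(i : 'I_N) (pi (D i).1 != (D i).2)%:R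
  + Num.sqrt ((ln (#|S|%:R) + ln (2 / delta)) / (2 * N%:R))
  + Num.sqrt ((ln (#|{ffun S -> A}|%:R) + ln (2 / delta)) / (2 * N%:R)).

End MDP.

(* Main.v *)
Require Import Defs.
From mathcomp Require Import all_boot all_order all_algebra.
From mathcomp Require Import all_classical all_reals all_analysis.
From mathcomp Require Import ring lra.
Import Order.TTheory GRing.Theory Num.Theory.
Import numFieldNormedType.Exports.
Set Implicit Arguments.
Unset Strict Implicit.
Local Open Scope ring_scope.

(** Write [r] for the state occupancy of the deterministic policy [pi], [q] for
    the occupancy of the behaviour policy on state-action pairs, and [e] for the
    empirical distribution of the data. The total variation distance equals
    [1 - \sum_s min (r s) (q (s, pi s))], while the terms of the bound other than
    the square roots add up to at least [1 - \sum_s min (r s) (e (s, pi s))]. As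
    [min (r s)] is concave with slope [0] or [1] at [q (s, pi s)], the difference
    is at most the sum of [e (s, pi s) - q (s, pi s)] over the set of states with
    [q (s, pi s) < r s]. This set does not depend on the data, so for each fixed
    [pi] the difference is controlled by Hoeffding's inequality for the mean of
    independent indicators. A union bound over all deterministic policies yields
    the square root involving their number; the other square root is only needed
    to be nonnegative. *)

(** * Hoeffding's inequality on a finite sample space *)

Lemma le_of_derive_ge0 (R : realType) (f df : R -> R) :
  (forall x : R, is_derive x 1 f (df x)) ->
  (forall x, 0 <= x -> 0 <= df x) -> forall x, 0 <= x -> f 0 <= f x.
Proof.
move=> fdf df0 x x0.
have cf : ({within `[0%R, x], continuous f})%classic.
  apply: continuous_subspaceT => y.
  by apply: differentiable_continuous; apply/derivable1_diffP; have [] := fdf y.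
have [c] := MVT_segment x0 (fun y _ => fdf y) cf.
rewrite in_itv/= => /andP[c0 _] e.
by rewrite -subr_ge0 e mulr_ge0 ?df0 // subr0.
Qed.

(** Hoeffding's lemma for a Bernoulli variable. The logarithmic gap [h] vanishes at 0, and so does
    its derivative [g]; thus it suffices that [g] has a nonnegative derivative. *)
Lemma bernoulli_mgf_le (R : realType) (p l : R) :
  0 <= p -> p <= 1 -> 0 <= l ->
  1 - p + p * expR l <= expR (l * p + l ^+ 2 / 8).
Proof.
move=> p0 p1 l0.
pose D : R -> R := cst (1 - p) + cst p * expR.
have DE x : D x = 1 - p + p * expR x by [].
have D0 x : 0 < D x.
  rewrite DE; have := expR_gt0 x.
  have [->|pn1] := eqVneq p 1; first by rewrite subrr add0r mul1r.
  move=> e0; apply: ltr_wpDr; first by rewrite mulr_ge0 // ltW.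
  by rewrite subr_gt0 lt_neqAle pn1.
have dD (x : R) : is_derive x 1 D (p * expR x).
  by apply: is_derive_eq; rewrite /= scaler0 addr0 add0r.
pose g : R -> R := cst (p - 1) + 4^-1 *: id + cst (1 - p) * (fun y => (D y)^-1).
have gE x : g x = p - 1 + 4^-1 * x + (1 - p) * (D x)^-1 by [].
have dV (x : R) := is_deriveV (lt0r_neq0 (D0 x)) (dD x).
have g_ge0 x : 0 <= x -> 0 <= g x.
  move=> x0.
  have g00 : g 0 = 0.
    by rewrite gE DE expR0 mulr1 subrK mulr0 addr0 invr1 mulr1 addrA subrK subrr.
  have dg (y : R) : is_derive y 1 g (4^-1 - (1 - p) * (p * expR y) / D y ^+ 2).
    have dlin := is_deriveD (is_derive_cst (p - 1) y 1)
      (is_deriveZ 4^-1 (is_derive_id y 1)).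
    have dinv := is_deriveM (is_derive_cst (1 - p) y 1) (dV y).
    apply: (is_derive_eq (is_deriveD dlin dinv)).
    by rewrite /= /GRing.scale /=; ring.
  have dg0 y : 0 <= y -> 0 <= 4^-1 - (1 - p) * (p * expR y) / D y ^+ 2.
    move=> _; rewrite subr_ge0 ler_pdivrMr ?exprn_gt0 // DE.
    (* [D y ^+ 2 - 4 * ((1 - p) * (p * expR y))] is exactly this square. *)
    by have := sqr_ge0 (1 - p - p * expR y); lra.
  by rewrite -g00; exact: (le_of_derive_ge0 dg dg0).
pose h : R -> R := p *: id + (8^-1 : R) *: id ^+ 2 - (@ln R \o D).
have hE x : h x = p * x + 8^-1 * x ^+ 2 - ln (D x) by [].
have dl (x : R) := is_derive1_comp (is_derive1_ln (D0 x)) (dD x).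
suff : 0 <= h l.
  rewrite hE subr_ge0 -DE => hl.
  by rewrite -[leLHS]lnK ?posrE // ler_expR mulrC [_ / 8]mulrC.
have h00 : h 0 = 0 by rewrite hE DE expR0 mulr1 subrK ln1; ring.
have dh (y : R) : is_derive y 1 h (p + 4^-1 * y - (D y)^-1 * (p * expR y)).
  have dpoly := is_deriveD (is_deriveZ p (is_derive_id y 1))
    (is_deriveZ 8^-1 (is_deriveX 2 (is_derive_id y 1))).
  apply: (is_derive_eq (is_deriveB dpoly (dl y))).
  by rewrite /= /GRing.scale /=; field; exact: lt0r_neq0.
have dh0 y : 0 <= y -> 0 <= p + 4^-1 * y - (D y)^-1 * (p * expR y).
  move=> /g_ge0; rewrite gE.
  have -> : p * expR y = D y - (1 - p) by rewrite DE; ring.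
  by rewrite mulrBr mulVf ?gt_eqF //; lra.
by rewrite -h00; exact: (le_of_derive_ge0 dh dh0).
Qed.

(** Independence: distributivity expands the power into a sum over all samples. *)
Lemma sum_iid_weight (R : realType) (T : finType) (q f : T -> R) (N : nat) :
  \sum_(D : {ffun 'I_N -> T}) \prod_(i < N) (q (D i) * f (D i))
  = (\sum_x q x * f x) ^+ N.
Proof.
rewrite -(@bigA_distr_bigA _ _ _ _ _ _ _ (fun _ x => q x * f x)).
by rewrite prodr_const card_ord.
Qed.

Lemma hoeffding_finite (R : realType) (T : finType) (q : T -> R) (N : nat)
    (B : pred T) (t : R) :
  is_dist q -> 0 <= t ->
  \sum_(D : {ffun 'I_N -> T}) (\prod_(i < N) q (D i)) *
     (N%:R * (\sum_(x | B x) q x + t) < \sum_(i < N) (B (D i))%:R)%R%:R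
  <= expR (- (2 * N%:R * t ^+ 2)).
Proof.
move=> [q0 q1] t0; set p := \sum_(x | B x) q x.
have p0 : 0 <= p by apply: sumr_ge0.
have pC : \sum_(x | ~~ B x) q x = 1 - p.
  by rewrite -q1 [\sum_x q x](bigID B) /= -/p addrAC subrr add0r.
have p1 : p <= 1 by rewrite -subr_ge0 -pC sumr_ge0.
(* The exponent [l = 4 * t] minimises [l ^+ 2 / 8 - l * t], with value [- (2 * t ^+ 2)]. *)
have l0 : 0 <= 4 * t by rewrite mulr_ge0.
have mgf : \sum_x q x * expR (4 * t * (B x)%:R) = 1 - p + p * expR (4 * t).
  rewrite (bigID B) /= addrC; congr (_ + _).
    by rewrite -pC; apply: eq_bigr => x /negbTE ->; rewrite mulr0 expR0 mulr1.
  by rewrite mulr_suml; apply: eq_bigr => x ->; rewrite mulr1.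
pose c := expR (- (4 * t * (N%:R * (p + t)))).
(* Chernoff's method: the indicator of the event is at most the exponential of [4 * t] times the
   excess of the count over [N%:R * (p + t)]. *)
apply: (@le_trans _ _ (\sum_(D : {ffun 'I_N -> T})
    (\prod_(i < N) (q (D i) * expR (4 * t * (B (D i))%:R))) * c)).
  apply: ler_sum => D _.
  rewrite big_split /= -expR_sum -mulr_sumr -[leRHS]mulrA ler_wpM2l ?prodr_ge0 //.
  rewrite /c -expRD -mulrBr.
  case: ltP => /= [h|_]; last exact: expR_ge0.
  by rewrite -[leLHS]expR0 ler_expR mulr_ge0 // subr_ge0 ltW.
rewrite -mulr_suml (sum_iid_weight q (fun x => expR (4 * t * (B x)%:R))) mgf.
apply: (@le_trans _ _ (expR (4 * t * p + (4 * t) ^+ 2 / 8) ^+ N * c)).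
  rewrite ler_wpM2r ?expR_ge0 // lerXn2r ?nnegrE ?expR_ge0 ?bernoulli_mgf_le //.
  by rewrite addr_ge0 ?subr_ge0 // mulr_ge0 // expR_ge0.
by rewrite -expRM_natl /c -expRD ler_expR le_eqVlt; apply/orP; left; apply/eqP; field.
Qed.

(** * Occupancies as probability distributions *)

Section Occupancy.
Variables (R : realType) (S A : finType) (gamma : R) (mu : {ffun S -> R})
  (P : mdp_kernel R S A).
Hypotheses (gamma0 : 0 <= gamma) (gamma1 : gamma < 1).
Hypotheses (mu_dist : is_dist mu) (P_kernel : is_kernel P).

Lemma det_pol_spolicy (pi : {ffun S -> A}) : is_spolicy (det_pol R pi).
Proof.
move=> s; split=> [a|]; first by rewrite !ffunE; case: ifP.
under eq_bigr do rewrite !ffunE.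
by rewrite -big_mkcond big_pred1_eq.
Qed.

Lemma state_dist_is_dist (pi : spolicy R S A) t :
  is_spolicy pi -> is_dist (state_dist mu P pi t).
Proof.
move=> pi_pol; elim: t => [|t [IH0 IH1]] //; split=> [s|] /=.
  apply: sumr_ge0 => s' _; apply: sumr_ge0 => a _.
  by rewrite !mulr_ge0 //; [case: (pi_pol s') | case: (P_kernel s' a)].
rewrite exchange_big -[RHS]IH1 /=; apply: eq_bigr => s _.
rewrite exchange_big /=.
under eq_bigr => a _ do rewrite -mulr_sumr (P_kernel s a).2 mulr1.
by rewrite -mulr_sumr (pi_pol s).2 mulr1.
Qed.

(** The partial sums increase and stay below the geometric sum [(1 - gamma)^-1], as each state
    probability is at most one. *)
Lemma is_cvg_occ (pi : spolicy R S A) s : is_spolicy pi ->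
  cvgn (fun n => \sum_(0 <= t < n) gamma ^+ t * state_dist mu P pi t s).
Proof.
move=> pi_pol.
have term0 t : 0 <= gamma ^+ t * state_dist mu P pi t s.
  by rewrite mulr_ge0 ?exprn_ge0 //; case: (state_dist_is_dist t pi_pol).
apply: nondecreasing_is_cvgn.
  by apply/nondecreasing_seqP => n; rewrite big_nat_recr //= lerDl.
exists (1 - gamma)^-1 => _ [n _ <-].
apply: (@le_trans _ _ (\sum_(0 <= t < n) gamma ^+ t)).
  apply: ler_sum => t _; rewrite ler_piMr ?exprn_ge0 //.
  have [d0 d1] := state_dist_is_dist t pi_pol.
  by rewrite -d1 (bigD1 s) //= lerDl sumr_ge0.
rewrite big_mkord -[leRHS]div1r ler_pdivlMr ?subr_gt0 // mulrC.
by rewrite -opprB mulNr -subrX1 opprB lerBlDr lerDl exprn_ge0.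
Qed.

Lemma occ_is_dist (pi : spolicy R S A) :
  is_spolicy pi -> is_dist (occ gamma mu P pi).
Proof.
move=> pi_pol; split=> [s|].
  apply: mulr_ge0; first by rewrite subr_ge0 ltW.
  apply: limr_ge; first exact: is_cvg_occ.
  apply: nearW => n; apply: sumr_ge0 => t _.
  by rewrite mulr_ge0 ?exprn_ge0 //; case: (state_dist_is_dist t pi_pol).
rewrite -mulr_sumr.
(* The total mass comes from uniqueness of limits: summed over the states, the partial sums are
   those of the geometric series. *)
have cvg_tot : ((fun n => \sum_(0 <= t < n) gamma ^+ t) @ \oo -->
    \sum_s limn (fun n => \sum_(0 <= t < n) gamma ^+ t * state_dist mu P pi t s))%classic.
  rewrite [X in (X @ _)%classic](_ : _ = fun n =>
    \sum_s \sum_(0 <= t < n) gamma ^+ t * state_dist mu P pi t s).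
    by apply: (cvg_big add_continuous) => s _; exact: is_cvg_occ.
  apply/funext => n; rewrite exchange_big /=; apply: eq_bigr => t _.
  by rewrite -mulr_sumr (state_dist_is_dist t pi_pol).2 mulr1.
have cvg_geo : ((fun n => \sum_(0 <= t < n) gamma ^+ t) @ \oo --> (1 - gamma)^-1)%classic.
  rewrite -[(1 - gamma)^-1]mul1r.
  rewrite [X in (X @ _)%classic](_ : _ = series (geometric 1 gamma)).
    by apply: cvg_geometric_series; rewrite ger0_norm.
  by apply/funext => n; apply: eq_bigr => t _; rewrite /geometric /= mul1r.
rewrite (cvg_unique _ cvg_tot cvg_geo) //.
by rewrite mulfV // gt_eqF // subr_gt0.
Qed.

Lemma occSA_is_dist (pi : spolicy R S A) :
  is_spolicy pi -> is_dist (occSA gamma mu P pi).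
Proof.
move=> pi_pol; have [occ0 occ1] := occ_is_dist pi_pol.
split=> [sa|]; first by rewrite mulr_ge0 //; case: (pi_pol sa.1).
rewrite -[RHS]occ1 -(pair_bigA _ (fun s a => occSA gamma mu P pi (s, a))) /=.
apply: eq_bigr => s _; rewrite /occSA /=.
by rewrite -mulr_suml (pi_pol s).2 mul1r.
Qed.

End Occupancy.

(** * Empirical distributions of the data *)

Definition emp_sa (R : realType) (S A : finType) N (D : dataset S A N)
    (x : S * A) : R :=
  #|[set i : 'I_N | D i == x]|%:R / N%:R.

Lemma sum_graph (R : realType) (S A : finType) (pi : {ffun S -> A})
    (C : pred S) (F : S * A -> R) :
  \sum_(x | (pi x.1 == x.2) && C x.1) F x = \sum_(s | C s) F (s, pi s).
Proof.
rewrite (reindex_onto (fun s => (s, pi s)) fst) /=; last first.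
  by move=> [s a] /= /andP[/eqP <-].
by apply: eq_bigl => s; rewrite !eqxx andbT.
Qed.

Section Empirical.
Variables (R : realType) (S A : finType) (N : nat) (D : dataset S A N).
Hypothesis N0 : (0 < N)%N.

Let Nneq0 : N%:R != 0 :> R. Proof. by rewrite pnatr_eq0 -lt0n. Qed.

Lemma sum_data (T : finType) (f : 'I_N -> T) (C : pred T) :
  \sum_(i < N) (C (f i))%:R = \sum_(x | C x) #|[set i | f i == x]|%:R :> R.
Proof.
rewrite -natr_sum -natr_sum; congr _%:R.
rewrite -big_mkcond sum1_card -sum1_card (partition_big f C) //=.
apply: eq_bigr => x Cx; rewrite -sum1_card; apply: eq_bigl => i.
by rewrite inE !unfold_in /=; case: eqP => [->|]; rewrite ?Cx ?andbF.
Qed.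

Lemma emp_state_sum1 : \sum_s emp_state R D s = 1.
Proof.
rewrite /emp_state -mulr_suml.
rewrite -(sum_data (fun i => (D i).1) xpredT) sumr_const card_ord.
by rewrite mulfV.
Qed.

Lemma emp_sa_ge0 x : 0 <= emp_sa R D x.
Proof. by rewrite divr_ge0 ?ler0n. Qed.

Lemma emp_sa_le s a : emp_sa R D (s, a) <= emp_state R D s.
Proof.
rewrite ler_wpM2r ?invr_ge0 ?ler0n // ler_nat subset_leq_card //.
by apply/fintype.subsetP => i; rewrite !inE => /eqP ->.
Qed.

Lemma emp_state_notin s : ~~ in_data D s -> emp_state R D s = 0.
Proof.
move=> /existsPn h; rewrite /emp_state eq_card0 ?mul0r // => i.
by rewrite inE; apply/negbTE.
Qed.

(** Both sides equal one minus the empirical mass of the graph of [pi]. As a sum over states, the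
    training error can be compared state by state with the other terms. *)
Lemma emp_error (pi : {ffun S -> A}) :
  N%:R^-1 * \sum_(i < N) (pi (D i).1 != (D i).2)%:R
  = \sum_s (emp_state R D s - emp_sa R D (s, pi s)).
Proof.
rewrite sumrB emp_state_sum1 -[X in X - _](mulVf Nneq0).
rewrite -(sum_graph pi xpredT) /emp_sa -mulr_suml [X in _ - X]mulrC -mulrBr.
rewrite -(sum_data D (fun x => (pi x.1 == x.2) && true)); congr (_ * _).
rewrite -[N in N%:R]card_ord -sum1_card natr_sum -sumrB.
by apply: eq_bigr => i _; rewrite andbT; case: eqP; rewrite ?subrr ?subr0.
Qed.

End Empirical.

(** * Total variation through minima *)

Lemma normB_min (R : realType) (x y : R) :
  2^-1 * `|x - y| = 2^-1 * (x + y) - Num.min x y.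
Proof. by case: (lerP x y) => h; lra. Qed.

(* Concavity of [min r]: its slope at [q] is [1] if [q < r] and [0] otherwise,
   which does not depend on the sample. *)
Lemma min_le_slope (R : realType) (r e q : R) :
  Num.min r e - Num.min r q <= (e - q) * (q < r)%R%:R.
Proof. by case: (ltP q r) => /= h; case: (leP r e) => h'; lra. Qed.

Lemma dTV_min (R : realType) (T : finType) (p q : T -> R) :
  is_dist p -> is_dist q -> dTV p q = 1 - \sum_x Num.min (p x) (q x).
Proof.
move=> [_ p1] [_ q1]; rewrite /dTV mulr_sumr.
under eq_bigr do rewrite normB_min.
by rewrite sumrB -mulr_sumr big_split /= p1 q1; congr (_ - _); lra.
Qed.

(** * Comparison with the bound for a fixed sample *)

Section Deterministic.
Variables (R : realType) (S A : finType) (gamma : R) (mu : {ffun S -> R})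
  (P : mdp_kernel R S A) (pib pi0 : spolicy R S A).
Hypotheses (gamma0 : 0 <= gamma) (gamma1 : gamma < 1).
Hypotheses (mu_dist : is_dist mu) (P_kernel : is_kernel P).
Hypotheses (pib_pol : is_spolicy pib).

(** Off the graph of [pi] the occupancy of [det_pol R pi] vanishes, and the minimum with it. *)
Lemma dTV_det_pol (pi : {ffun S -> A}) :
  dTV (occSA gamma mu P (det_pol R pi)) (occSA gamma mu P pib)
  = 1 - \sum_s Num.min (occ gamma mu P (det_pol R pi) s)
                       (occSA gamma mu P pib (s, pi s)).
Proof.
have dp := det_pol_spolicy R pi.
have qd := occSA_is_dist gamma0 gamma1 mu_dist P_kernel pib_pol.
rewrite dTV_min //; last exact: occSA_is_dist.
congr (_ - _); rewrite (bigID (fun x => (pi x.1 == x.2) && true)) /= (sum_graph pi xpredT).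
rewrite [X in _ + X]big1 ?addr0 => [|[s a] /=].
  by apply: eq_bigr => s _; rewrite {1}/occSA /= !ffunE eqxx mul1r.
rewrite andbT eq_sym => /negbTE ne.
by rewrite {1}/occSA /= !ffunE ne mul0r min_l //; case: qd.
Qed.

Lemma cbound_ge (N : nat) (D : dataset S A N) (pi : {ffun S -> A}) (delta : R) :
  (0 < N)%N ->
  1 - \sum_s Num.min (occ gamma mu P (det_pol R pi) s) (emp_sa R D (s, pi s))
  + Num.sqrt ((ln (#|{ffun S -> A}|%:R) + ln (2 / delta)) / (2 * N%:R))
  <= cbound gamma mu P pib pi0 pi delta D.
Proof.
move=> N0; rewrite /cbound lerD2r.
set rpi := occ _ _ _ (det_pol _ _).
have [rpi0 rpi1] : is_dist rpi by apply: occ_is_dist => //; exact: det_pol_spolicy.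
apply: ler_wpDr; first exact: sqrtr_ge0.
have err_in : \sum_s (emp_state R D s - emp_sa R D (s, pi s))
    = \sum_(s | in_data D s) (emp_state R D s - emp_sa R D (s, pi s)).
  rewrite [LHS](bigID (in_data D)) /= [X in _ + X]big1 ?addr0 // => s sD.
  have := emp_sa_le R D s (pi s); have := emp_sa_ge0 R D (s, pi s).
  by rewrite emp_state_notin //; lra.
rewrite emp_error // err_in !mulr_sumr.
rewrite [leLHS](_ : _ = \sum_s (2^-1 * (rpi s + emp_state R D s)
    - Num.min (rpi s) (emp_sa R D (s, pi s)))); last first.
  rewrite sumrB -mulr_sumr big_split /= rpi1 emp_state_sum1 //.
  by congr (_ - _); lra.
rewrite (bigID (in_data D)) /=.
rewrite -!big_split /= -addrA -big_split /= addrC; apply: lerD.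
  (* Off the data both empirical masses are zero, so the left summand is half of [rpi s]; the
     triangle inequality through [r0' s] bounds it. *)
  apply: ler_sum => s sD.
  have := emp_sa_le R D s (pi s); have := emp_sa_ge0 R D (s, pi s).
  have := rpi0 s; rewrite emp_state_notin // => r0 e0 e1.
  rewrite min_r; last by lra.
  set rb := occ _ _ _ pib; set r0' := occ _ _ _ pi0.
  have := ler_distD (r0' s) (rpi s) (rb s); have := ler_norm (rpi s - rb s).
  lra.
(* On the data, the claim is that lowering the second argument of [min (rpi s)] from [emp_state] to
   [emp_sa] lowers the minimum by at most their difference. *)
apply: ler_sum => s sD.
have := emp_sa_le R D s (pi s); have := emp_sa_ge0 R D (s, pi s).
have := rpi0 s; rewrite normB_min => r0 e0 e1.
case: (leP (rpi s) (emp_state R D s)) => h1;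
  by case: (leP (rpi s) (emp_sa R D (s, pi s))) => h2; lra.
Qed.

Lemma dTV_le_cbound (N : nat) (D : dataset S A N) (pi : {ffun S -> A})
    (delta : R) :
  let q := occSA gamma mu P pib in
  let B x := (pi x.1 == x.2) && (q (x.1, pi x.1) < occ gamma mu P (det_pol R pi) x.1) in
  let t := Num.sqrt ((ln (#|{ffun S -> A}|%:R) + ln (2 / delta)) / (2 * N%:R)) in
  (0 < N)%N ->
  \sum_(i < N) (B (D i))%:R <= N%:R * (\sum_(x | B x) q x + t) ->
  dTV (occSA gamma mu P (det_pol R pi)) q <= cbound gamma mu P pib pi0 pi delta D.
Proof.
move=> q B t N0 good; rewrite dTV_det_pol.
pose C s := q (s, pi s) < occ gamma mu P (det_pol R pi) s.
apply: le_trans (cbound_ge D pi delta N0); rewrite -/t.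
have sumB F : \sum_(x | B x) F x = \sum_(s | C s) F (s, pi s) :> R.
  exact: (sum_graph pi C F).
(* Divided by [N], the count of data in [B] becomes the sum of [emp_sa] along the graph of [pi] over
   [C]. *)
move: good; rewrite (sum_data R D B) mulrC -ler_pdivrMr ?ltr0n // mulr_suml.
rewrite !sumB -lerBlDl -sumrB => good.
suff : \sum_s (Num.min (occ gamma mu P (det_pol R pi) s) (emp_sa R D (s, pi s))
    - Num.min (occ gamma mu P (det_pol R pi) s) (q (s, pi s))) <= t.
  by rewrite sumrB; lra.
apply: le_trans good; rewrite [leRHS]big_mkcond /=; apply: ler_sum => s _.
apply: (le_trans (min_le_slope _ _ _)); rewrite /C -/q.
by case: ltP => _; rewrite ?mulr1 ?mulr0.
Qed.

End Deterministic.

Theorem theorem1 (R : realType) (S A : finType)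
  (gamma : R) (mu : {ffun S -> R}) (P : mdp_kernel R S A)
  (pib pi0 : spolicy R S A)
  (bc : forall N : nat, dataset S A N -> {ffun S -> A})
  (N : nat) (delta : R) :
  0 <= gamma -> gamma < 1 ->
  is_dist mu -> is_kernel P ->
  is_spolicy pib -> is_spolicy pi0 ->
  (0 < N)%N ->
  0 < delta -> delta < 1 ->
  prob_iid (occSA gamma mu P pib)
    (fun D : dataset S A N =>
       ~~ realizable D ==>
       (dTV (occSA gamma mu P (det_pol R (bc N D))) (occSA gamma mu P pib)
          <= cbound gamma mu P pib pi0 (bc N D) delta D))
  >= 1 - delta.
Proof.
move=> gamma0 gamma1 mu_dist P_kernel pib_pol _ N0 delta0 delta1.
set q := occSA gamma mu P pib.
have q_dist : is_dist q by exact: occSA_is_dist.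
have [q0 q1] := q_dist.
(* Inverting [ln] below requires a positive number of policies: [q] has mass one, so an action
   exists, and with it a constant policy. *)
have card_gt0 : (0 < #|{ffun S -> A}|)%N.
  case: (pickP (fun _ : S * A => true)) => [[s a] _|noSA].
    by apply/card_gt0P; exists [ffun=> a].
  by move: q1; rewrite big_pred0 // => /eqP; rewrite eq_sym oner_eq0.
set t := Num.sqrt ((ln (#|{ffun S -> A}|%:R) + ln (2 / delta)) / (2 * N%:R)).
pose B (pi : {ffun S -> A}) (x : S * A) :=
  (pi x.1 == x.2) && (q (x.1, pi x.1) < occ gamma mu P (det_pol R pi) x.1).
pose bad pi (D : dataset S A N) : bool :=
  N%:R * (\sum_(x | B pi x) q x + t) < \sum_(i < N) (B pi (D i))%:R.
(* All policies are summed over because [bc N D] depends on the sample. Each bad event has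
   probability at most [delta / 2] divided by the number of policies. *)
have bad_small : \sum_pi prob_iid q (bad pi) <= delta.
  apply: (@le_trans _ _ (\sum_(pi : {ffun S -> A}) expR (- (2 * N%:R * t ^+ 2)))).
    by apply: ler_sum => pi _; apply: hoeffding_finite => //; exact: sqrtr_ge0.
  have NR : 0 < N%:R :> R by rewrite ltr0n.
  have cR : 1 <= #|{ffun S -> A}|%:R :> R by rewrite ler1n.
  have d2 : 1 <= 2 / delta by rewrite ler_pdivlMr //; lra.
  rewrite sumr_const -[leLHS]mulr_natl sqr_sqrtr; last first.
    by rewrite divr_ge0 ?addr_ge0 ?ln_ge0 ?mulr_ge0 // ltW.
  rewrite [2 * _ * _]mulrC mulfVK ?mulf_neq0 ?gt_eqF // opprD expRD.
  rewrite !expRN !lnK ?posrE ?ltr0n ?divr_gt0 //.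
  by rewrite mulrA mulfV ?pnatr_eq0 -?lt0n // mul1r invf_div; lra.
have total : \sum_(D : dataset S A N) \prod_(i < N) q (D i) = 1.
  have := sum_iid_weight q (fun=> 1) N.
  rewrite -mulr_suml q1 mulr1 expr1n => tot; rewrite -[RHS]tot.
  by apply: eq_bigr => D _; apply: eq_bigr => i _; rewrite mulr1.
apply: (@le_trans _ _ (1 - \sum_pi prob_iid q (bad pi))); first by lra.
rewrite /prob_iid exchange_big -[X in X - _]total -sumrB.
apply: ler_sum => D _ /=.
rewrite -mulr_sumr -[X in X - _]mulr1 -mulrBr ler_wpM2l ?prodr_ge0 //.
case: implyP => h /=; first by rewrite lerBlDr lerDl sumr_ge0.
(* When the bound fails, the bad event of the returned policy must occur, so the sum of indicators
   is at least one. *)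
rewrite subr_le0 (bigD1 (bc N D)) //= ler_wpDr ?sumr_ge0 //.
rewrite ler1n lt0b; apply: contra_notT h; rewrite /bad -leNgt => good _.
exact: dTV_le_cbound.
Qed.
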